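(* In the game of Picaria played from the empty board with player X moving first, player X cannot win; that is, O has a strategy which guarantees that X never obtains three X-stones on a line, whatever X does.
   Context: Picaria is played on the nine nodes of a $3\times 3$ grid. Two nodes are adjacent if they are distinct neighbours horizontally, vertically or diagonally. A line is one of the eight triples of nodes forming a row, a column or one of the two main diagonals. Two players, X and O, each own three stones and alternate turns, X first. Phase 1 (placement): the mover places one of its stones on an empty node, until all six stones are on the board. Phase 2 (sliding): X starts, and the mover slides one of its own stones to an adjacent empty node. A player wins as soon as its three stones occupy a line. Play may go on forever, in which case nobody wins. *)

(* Defs.v *)
From HB Require Import structures.
From mathcomp Require Import all_boot.

Set Implicit Arguments.
Unset Strict Implicit.
Unset Printing Implicit Defensive.

Definition node := ('I_3 * 'I_3)%type.

Definition near (i j : 'I_3) : bool := (i <= j.+1) && (j <= i.+1).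

Definition adjacent (u v : node) : bool :=
  [&& u != v, near u.1 v.1 & near u.2 v.2].

Definition row (i : 'I_3) : {set node} := [set u : node | u.1 == i].
Definition column (j : 'I_3) : {set node} := [set u : node | u.2 == j].
Definition diagonal : {set node} := [set u : node | u.1 == u.2].
Definition antidiagonal : {set node} := [set u : node | u.1 + u.2 == 2].

Definition is_line (L : {set node}) : bool :=
  [|| [exists i, L == row i], [exists j, L == column j],
      L == diagonal | L == antidiagonal].

Variant player := PlayerX | PlayerO.

Definition is_playerX (p : player) : bool := if p is PlayerX then true else false.
Definition player_of_bool (b : bool) : player := if b then PlayerX else PlayerO.

Lemma is_playerXK : cancel is_playerX player_of_bool.
Proof. by case. Qed.

HB.instance Definition _ := Finite.copy player (can_type is_playerXK).

Definition opponent (p : player) : player :=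
  if p is PlayerX then PlayerO else PlayerX.

Definition board := {ffun node -> option player}.

Definition occupied (b : board) : {set node} := [set v | b v != None].
Definition stones (b : board) (p : player) : {set node} :=
  [set v | b v == Some p].

Definition wins (b : board) (p : player) : bool :=
  [exists L : {set node}, is_line L && (L \subset stones b p)].

Definition over (b : board) : bool := wins b PlayerX || wins b PlayerO.

Record position := Position { pos_board : board; mover : player }.

Definition start : position := Position [ffun=> None] PlayerX.

Variant move := Place of node | Slide of node & node.

(* Stones are never removed, so the placement phase is recognized by there
   being fewer than six stones on the board; strict alternation then gives each
   player exactly three, and X is to move when the sliding phase begins. *)
Definition legal (s : position) (m : move) : bool :=
  let b := pos_board s in
  ~~ over b &&
  match m with
  | Place v => (#|occupied b| < 6) && (b v == None)
  | Slide u v =>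
      [&& #|occupied b| == 6, b u == Some (mover s), adjacent u v & b v == None]
  end.

Definition make_move (s : position) (m : move) : position :=
  let b := pos_board s in
  Position
    match m with
    | Place v => [ffun w => if w == v then Some (mover s) else b w]
    | Slide u v =>
        [ffun w => if w == v then Some (mover s)
                   else if w == u then None else b w]
    end
    (opponent (mover s)).

(* A finite play, possibly unfinished, is the list of moves made so far,
   oldest first. *)
Definition after (h : seq move) : position := foldl make_move start h.

Fixpoint legal_from (s : position) (h : seq move) : bool :=
  if h is m :: h' then legal s m && legal_from (make_move s m) h' else true.

Definition legal_play (h : seq move) : bool := legal_from start h.

(* A strategy may depend on the whole history; it must give a legal move at
   every legal unfinished play at which its owner is to move. *)
Definition is_strategy (p : player) (sigma : seq move -> move) : Prop :=
  forall h : seq move,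
    legal_play h -> mover (after h) = p -> ~~ over (pos_board (after h)) ->
    legal (after h) (sigma h).

Definition follows (p : player) (sigma : seq move -> move) (h : seq move) : Prop :=
  forall (h1 : seq move) (m : move) (h2 : seq move),
    h = h1 ++ m :: h2 -> mover (after h1) = p -> m = sigma h1.

(* Main.v *)
(* O always steers to one of 29 positions (up to the eight symmetries of the
   grid) with X to move, or wins.  This set contains the empty board, and every
   X-move out of it fails to complete a line and has an O-reply leading back to
   the set or completing an O-line, so X never wins.  The closure of the set is
   checked by evaluation.  Off this set O plays any legal move; one exists
   because with three stones each O is blocked only if it has already won,
   which is checked on all 1680 arrangements. *)

From HB Require Import structures.
From mathcomp Require Import all_boot zify.
Require Import Defs.

Set Implicit Arguments.
Unset Strict Implicit.
Unset Printing Implicit Defensive.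

(** Makes [move] a finite type, so that [pick] can choose O's replies. *)
Definition sum_of_move (m : move) : node + node * node :=
  match m with Place v => inl v | Slide u v => inr (u, v) end.
Definition move_of_sum (t : node + node * node) : move :=
  match t with inl v => Place v | inr (u, v) => Slide u v end.

Lemma sum_of_moveK : cancel sum_of_move move_of_sum.
Proof. by case. Qed.

HB.instance Definition _ := Finite.copy move (can_type sum_of_moveK).

(** * Boards as lists of nine cells *)

(* Boards are evaluated through their list of nine cells in reading order, as
   finite functions on nodes do not compute. *)
Definition index_of (v : node) : nat := 3 * v.1 + v.2.
Definition node_at (k : nat) : node := (inord (k %/ 3), inord (k %% 3)).
Definition cells (b : board) : seq (option player) :=
  mkseq (fun k => b (node_at k)) 9.

Lemma index_of_lt v : index_of v < 9.
Proof. by case: v => [[[|[|[|//]]] ?] [[|[|[|//]]] ?]]. Qed.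

Lemma index_ofK : cancel index_of node_at.
Proof.
by case=> i j; rewrite /node_at /index_of /= mulnC divnMDl // modnMDl
  divn_small // modn_small // addn0 !inord_val.
Qed.

Lemma node_atK k : k < 9 -> index_of (node_at k) = k.
Proof.
move=> lt_k9; rewrite /index_of /= !inordK ?ltn_mod ?ltn_divLR //.
by rewrite mulnC -divn_eq.
Qed.

Lemma nth_cells (b : board) v : nth None (cells b) (index_of v) = b v.
Proof. by rewrite nth_mkseq ?index_of_lt // index_ofK. Qed.

(** The nine nodes [node_at k] are a permutation of the enumeration of [node], and counting does not
    depend on order. *)
Lemma card_cells (a : pred (option player)) (b : board) :
  #|[set v | a (b v)]| = count a (cells b).
Proof.
have enum_node : perm_eq (enum {: node}) (mkseq node_at 9).
  apply: uniq_perm; first exact: enum_uniq.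
    rewrite map_inj_in_uniq ?iota_uniq // => k l; rewrite !mem_iota /= => lt_k lt_l.
    by move/(congr1 index_of); rewrite !node_atK.
  move=> v; rewrite mem_enum; apply/esym/mapP.
  by exists (index_of v); rewrite ?index_ofK // mem_iota index_of_lt.
have -> : cells b = map b (mkseq node_at 9) by rewrite -map_comp.
rewrite count_map -(permP enum_node) cardsE cardE -size_filter.
by rewrite /enum_mem -enumT filter_predT.
Qed.

Lemma cells_set (b : board) v x :
  cells [ffun w => if w == v then x else b w] =
  set_nth None (cells b) (index_of v) x.
Proof.
have lt_v := index_of_lt v.
apply: (@eq_from_nth _ None) => [|k].
  by rewrite size_set_nth !size_mkseq; apply/esym/maxn_idPr.
rewrite size_mkseq => lt_k; rewrite nth_set_nth /= !nth_mkseq // ffunE.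
by rewrite -(can_eq index_ofK) node_atK.
Qed.

(** * Lines, adjacency and moves on cells *)

Definition lines : seq (seq nat) :=
  [:: [:: 0; 1; 2]; [:: 3; 4; 5]; [:: 6; 7; 8];
      [:: 0; 3; 6]; [:: 1; 4; 7]; [:: 2; 5; 8];
      [:: 0; 4; 8]; [:: 2; 4; 6]].

Definition has_line (c : seq (option player)) (p : player) : bool :=
  has (all (fun k => nth None c k == Some p)) lines.

Lemma is_lineP (L : {set node}) :
  reflect (exists2 l, l \in lines & L = [set v | index_of v \in l]) (is_line L).
Proof.
have rowE k : k < 3 -> row (inord k) =
    [set v | index_of v \in [:: 3 * k; 3 * k + 1; 3 * k + 2]].
  move=> lt_k; apply/setP=> -[i j]; rewrite !inE -val_eqE /= inordK //.
  by case: k i j lt_k => [|[|[|//]]] [[|[|[|//]]] ?] [[|[|[|//]]] ?].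
have columnE k : k < 3 -> column (inord k) =
    [set v | index_of v \in [:: k; 3 + k; 6 + k]].
  move=> lt_k; apply/setP=> -[i j]; rewrite !inE -val_eqE /= inordK //.
  by case: k i j lt_k => [|[|[|//]]] [[|[|[|//]]] ?] [[|[|[|//]]] ?].
have diagonalE : diagonal = [set v | index_of v \in [:: 0; 4; 8]].
  by apply/setP=> -[[[|[|[|//]]] ?] [[|[|[|//]]] ?]]; rewrite !inE.
have antidiagonalE : antidiagonal = [set v | index_of v \in [:: 2; 4; 6]].
  by apply/setP=> -[[[|[|[|//]]] ?] [[|[|[|//]]] ?]]; rewrite !inE.
apply: (iffP or4P) => [[/existsP[i]|/existsP[i]||] /eqP->|[l]].
- rewrite -(inord_val i) rowE //; case: i => -[|[|[|//]]] ? /=;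
    by eexists; last reflexivity.
- rewrite -(inord_val i) columnE //; case: i => -[|[|[|//]]] ? /=;
    by eexists; last reflexivity.
- by rewrite diagonalE; eexists; last reflexivity.
- by rewrite antidiagonalE; eexists; last reflexivity.
rewrite !inE; do ![case/orP=> [/eqP->|]] => [||||||| /eqP->] ->.
- by apply: Or41; apply/existsP; exists (inord 0); rewrite rowE.
- by apply: Or41; apply/existsP; exists (inord 1); rewrite rowE.
- by apply: Or41; apply/existsP; exists (inord 2); rewrite rowE.
- by apply: Or42; apply/existsP; exists (inord 0); rewrite columnE.
- by apply: Or42; apply/existsP; exists (inord 1); rewrite columnE.
- by apply: Or42; apply/existsP; exists (inord 2); rewrite columnE.
- by apply: Or43; rewrite diagonalE.
- by apply: Or44; rewrite antidiagonalE.
Qed.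

Lemma wins_cells b p : wins b p = has_line (cells b) p.
Proof.
apply/existsP/hasP => [[L /andP[/is_lineP[l l_line ->] /subsetP sub]]|[l l_line all_l]].
  exists l => //; apply/allP => k k_l.
  (* That every index in [lines] is below 9 is settled by computation. *)
  have lt_k : k < 9 by apply: (allP (allP (isT : all (all (gtn 9)) lines) l l_line)).
  have := sub (node_at k); rewrite !inE node_atK // => /(_ k_l).
  by rewrite nth_mkseq.
exists [set v | index_of v \in l]; apply/andP; split; first by apply/is_lineP; exists l.
by apply/subsetP => v; rewrite !inE => /(allP all_l); rewrite nth_cells.
Qed.

(** Quotient and remainder by 3 are the row and the column of a cell. The list is stored already
    evaluated. *)
Definition adjacent_pairs : seq (nat * nat) := Eval compute in
  [seq kl <- [seq (k, l) | k <- iota 0 9, l <- iota 0 9] |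
    [&& kl.1 != kl.2, kl.1 %/ 3 <= (kl.2 %/ 3).+1, kl.2 %/ 3 <= (kl.1 %/ 3).+1,
        kl.1 %% 3 <= (kl.2 %% 3).+1 & kl.2 %% 3 <= (kl.1 %% 3).+1]].

Lemma adjacentE u v : adjacent u v = ((index_of u, index_of v) \in adjacent_pairs).
Proof.
by case: u v => [[[|[|[|//]]] ?] [[|[|[|//]]] ?]] [[[|[|[|//]]] ?] [[|[|[|//]]] ?]].
Qed.

(** Moves are listed without the clause [~~ over] of [legal], which [successor_legal] takes as a
    hypothesis. *)
Definition successors (p : player) (c : seq (option player)) :=
  let n := count (predC1 None) c in
  [seq set_nth None c k (Some p) |
    k <- iota 0 9 & (n < 6) && (nth None c k == None)] ++
  [seq set_nth None (set_nth None c kl.1 None) kl.2 (Some p) |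
    kl <- adjacent_pairs &
    [&& n == 6, nth None c kl.1 == Some p & nth None c kl.2 == None]].

Lemma occupied_cells b : #|occupied b| = count (predC1 None) (cells b).
Proof. exact: (card_cells (predC1 None)). Qed.

Lemma cells_place b p v :
  cells (pos_board (make_move (Position b p) (Place v))) =
  set_nth None (cells b) (index_of v) (Some p).
Proof. exact: cells_set. Qed.

Lemma cells_slide b p u v :
  cells (pos_board (make_move (Position b p) (Slide u v))) =
  set_nth None (set_nth None (cells b) (index_of u) None) (index_of v) (Some p).
Proof.
rewrite -!cells_set; congr cells; apply/ffunP => w.
by rewrite !ffunE.
Qed.

Lemma legal_successor s m : legal s m ->
  cells (pos_board (make_move s m)) \in successors (mover s) (cells (pos_board s)).
Proof.
case: s m => b p [v|u v] /andP[_ /=]; rewrite occupied_cells mem_cat.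
  case/andP=> lt6 bv; apply/orP; left; rewrite cells_place; apply: map_f.
  by rewrite mem_filter lt6 nth_cells bv mem_iota index_of_lt.
case/and4P=> eq6 bu uv bv; apply/orP; right; rewrite cells_slide.
apply: (map_f (fun kl => set_nth None (set_nth None _ kl.1 None) kl.2 _)
              (x := (index_of u, index_of v))).
by rewrite mem_filter /= eq6 !nth_cells bu bv -adjacentE.
Qed.

Lemma successor_legal s c :
    ~~ over (pos_board s) -> c \in successors (mover s) (cells (pos_board s)) ->
  exists2 m, legal s m & cells (pos_board (make_move s m)) = c.
Proof.
case: s => b p /= not_over; rewrite mem_cat -occupied_cells.
case/orP=> /mapP[k]; rewrite mem_filter.
  case/andP=> /andP[lt6 bk]; rewrite mem_iota /= => lt_k ->.
  have def_k := node_atK lt_k; exists (Place (node_at k)).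
    by rewrite /legal /= not_over lt6 -nth_cells def_k.
  by rewrite cells_place def_k.
case: k => k l /= /andP[/and3P[eq6 bk bl] kl ->].
have /andP[lt_k lt_l] : (k < 9) && (l < 9).
  exact: (allP (isT : all (fun kl => (kl.1 < 9) && (kl.2 < 9)) adjacent_pairs) _ kl).
have [def_k def_l] := (node_atK lt_k, node_atK lt_l).
exists (Slide (node_at k) (node_at l)).
  by rewrite /legal /= not_over eq6 adjacentE -!nth_cells def_k def_l bk bl kl.
by rewrite cells_slide def_k def_l.
Qed.

(** * The table of safe positions and the invariant *)

Definition cells_of_stones (xo : seq nat * seq nat) : seq (option player) :=
  mkseq (fun k => if k \in xo.1 then Some PlayerX
                  else if k \in xo.2 then Some PlayerO else None) 9.

(** The indices read the grid turned clockwise: the left column, from bottom to top, becomes the top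
    row. *)
Definition quarter_turn (c : seq (option player)) : seq (option player) :=
  [seq nth None c k | k <- [:: 6; 3; 0; 7; 4; 1; 8; 5; 2]].
Definition transpose (c : seq (option player)) : seq (option player) :=
  [seq nth None c k | k <- [:: 0; 3; 6; 1; 4; 7; 2; 5; 8]].
(** The rotations of a board and of its transpose are its images under the whole dihedral group.
    Listing them all reduces safety to literal membership in a table. *)
Definition symmetries (c : seq (option player)) : seq (seq (option player)) :=
  traject quarter_turn c 4 ++ traject quarter_turn (transpose c) 4.

(* One representative per symmetry class of the positions, X to move, that O
   steers to; found by computer search.  A pair lists the cells of the X-stones
   and those of the O-stones. *)
Definition safe_cells : seq (seq (option player)) :=
  undup (flatten [seq symmetries (cells_of_stones xo) | xo <-
  [:: ([::], [::]); ([:: 0], [:: 4]);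
      ([:: 1], [:: 4]); ([:: 4], [:: 0]);
      ([:: 0; 1], [:: 2; 4]); ([:: 0; 2], [:: 1; 4]);
      ([:: 1; 3], [:: 0; 4]); ([:: 2; 3], [:: 4; 7]);
      ([:: 0; 4], [:: 2; 8]); ([:: 1; 4], [:: 0; 7]);
      ([:: 1; 4], [:: 6; 7]); ([:: 3; 5], [:: 0; 4]);
      ([:: 2; 6], [:: 1; 4]); ([:: 0; 2; 3], [:: 1; 4; 6]);
      ([:: 1; 2; 3], [:: 0; 4; 5]); ([:: 1; 2; 3], [:: 0; 4; 7]);
      ([:: 0; 1; 4], [:: 2; 7; 8]); ([:: 0; 2; 4], [:: 1; 3; 5]);
      ([:: 1; 3; 4], [:: 0; 5; 7]); ([:: 1; 3; 4], [:: 2; 5; 7]);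
      ([:: 2; 3; 4], [:: 0; 5; 6]); ([:: 2; 3; 4], [:: 5; 6; 8]);
      ([:: 0; 3; 5], [:: 4; 7; 8]); ([:: 0; 2; 6], [:: 1; 3; 4]);
      ([:: 1; 2; 6], [:: 0; 4; 7]); ([:: 0; 5; 6], [:: 2; 3; 4]);
      ([:: 0; 5; 6], [:: 2; 3; 7]); ([:: 1; 5; 6], [:: 2; 3; 4]);
      ([:: 1; 5; 6], [:: 0; 4; 7])]]).

(** The invariant of O's play. When O is to move it looks one move ahead, so that keeping it through
    an X-move is a finite check on the table, and O's reply is read off from it. *)
Definition held (p : player) (c : seq (option player)) : bool :=
  let held_before_X c :=
    ~~ has_line c PlayerX && (has_line c PlayerO || (c \in safe_cells)) in
  if p is PlayerX then held_before_X c
  else ~~ has_line c PlayerX &&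
       (has_line c PlayerO || has held_before_X (successors PlayerO c)).

Lemma safe_cells_closed :
  all (fun c => all (held PlayerO) (successors PlayerX c)) safe_cells.
Proof. by vm_compute. Qed.

Definition held_position (s : position) : bool :=
  held (mover s) (cells (pos_board s)).

Lemma held_position_not_wins s : held_position s -> ~~ wins (pos_board s) PlayerX.
Proof. by rewrite wins_cells /held_position /held; case: (mover s) => /andP[]. Qed.

Lemma held_start : held_position start.
Proof.
rewrite /held_position.
(* The empty board is a finite function, so it is replaced by a literal list before evaluation. *)
have -> : cells (pos_board start) = nseq 9 None.
  by rewrite /cells /mkseq /= !ffunE.
by vm_compute.
Qed.

Lemma held_X_move s m :
  mover s = PlayerX -> legal s m -> held_position s -> held_position (make_move s m).
Proof.
rewrite /held_position => moverX legal_m.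
have /andP[+ _] := legal_m; rewrite /over !wins_cells negb_or => /andP[_ no_O].
have := legal_successor legal_m; rewrite [mover (make_move _ _)]/= moverX => succ_m.
(* A move was legal, so O has no line yet, and the invariant leaves only membership in the table. *)
case/andP=> _; rewrite (negPf no_O) /= => safe_s.
exact: (allP (allP safe_cells_closed _ safe_s) _ succ_m).
Qed.

Lemma held_O_move s :
    mover s = PlayerO -> ~~ over (pos_board s) -> held_position s ->
  exists2 m, legal s m & held_position (make_move s m).
Proof.
case: s => b p /= -> {p}; rewrite /held_position => not_over.
have := not_over; rewrite /over !wins_cells negb_or => /andP[_ no_O].
case/andP=> _; rewrite (negPf no_O) => /hasP[c succ_c held_c].
have [m legal_m def_c] := successor_legal (s := Position b PlayerO) not_over succ_c.
by exists m; rewrite // def_c.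
Qed.

(** * Stone counts and the existence of a move for O *)

(** The first disjunct describes placement, where X is one stone ahead exactly when O is to move;
    the second covers sliding, with either player to move. A strategy must answer every legal play,
    hence an invariant that holds off the safe table too. *)
Definition balanced (s : position) : bool :=
  let x := #|stones (pos_board s) PlayerX| in
  let o := #|stones (pos_board s) PlayerO| in
  (x <= 3) && (x == o + ~~ is_playerX (mover s)) || (x == 3) && (o == 3).

Lemma card_occupied b :
  #|occupied b| = #|stones b PlayerX| + #|stones b PlayerO|.
Proof.
have -> : occupied b = stones b PlayerX :|: stones b PlayerO.
  by apply/setP=> v; rewrite !inE; case: (b v) => [[]|].
rewrite cardsU disjoint_setI0 ?cards0 ?subn0 //.
by rewrite -setI_eq0; apply/eqP/setP=> v; rewrite !inE; case: (b v) => [[]|].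
Qed.

Lemma stones_place (b : board) p v q : b v = None ->
  #|stones (pos_board (make_move (Position b p) (Place v))) q| =
  (q == p) + #|stones b q|.
Proof.
move=> bv; set b' := pos_board _.
have b'E w : b' w = if w == v then Some p else b w by rewrite ffunE.
have [->|neq_qp] := eqVneq q p.
  have -> : stones b' p = v |: stones b p.
    by apply/setP=> w; rewrite !inE b'E; case: (w =P v); rewrite ?eqxx.
  by rewrite cardsU1 inE bv.
have -> // : stones b' q = stones b q.
apply/setP=> w; rewrite !inE b'E; case: (w =P v) => // ->.
by rewrite bv (inj_eq Some_inj) eq_sym (negPf neq_qp).
Qed.

Lemma stones_slide (b : board) p u v q : b u = Some p -> b v = None ->
  #|stones (pos_board (make_move (Position b p) (Slide u v))) q| = #|stones b q|.
Proof.
move=> bu bv; set b' := pos_board _.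
have b'E w : b' w = if w == v then Some p else if w == u then None else b w.
  by rewrite ffunE.
have [->|neq_qp] := eqVneq q p.
  have -> : stones b' p = v |: (stones b p :\ u).
    apply/setP=> w; rewrite !inE b'E; case: (w =P v); rewrite ?eqxx // => _.
    by case: (w =P u).
  by rewrite cardsU1 !inE bv andbF [in RHS](cardsD1 u) inE bu eqxx.
congr #|pred_of_set _|; apply/setP=> w; rewrite !inE b'E.
have neq_Some : (Some p == Some q) = false.
  by rewrite (inj_eq Some_inj) eq_sym (negPf neq_qp).
by case: (w =P v) => [->|_]; [rewrite bv | case: (w =P u) => // ->; rewrite bu].
Qed.

Lemma balanced_move s m : legal s m -> balanced s -> balanced (make_move s m).
Proof.
case: s m => b p [v|u v] /andP[_ /=]; rewrite card_occupied /balanced.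
  case/andP=> lt6 /eqP bv; rewrite !stones_place //.
  by move: #|_| #|_| lt6 => x o; case: p; rewrite /eq_op /=; lia.
case/and4P=> eq6 /eqP bu _ /eqP bv; rewrite !stones_slide //.
(* With six stones in all, parity excludes a lead of one, so each player has three. *)
by move: #|_| #|_| eq6 => x o; case: p bu => _; rewrite /=; lia.
Qed.

Lemma legal_play_rcons h m :
  legal_play (rcons h m) = legal_play h && legal (after h) m.
Proof.
rewrite /legal_play /after; elim: h start => [|n h IHh] s /=; first exact: andbT.
by rewrite IHh andbA.
Qed.

Lemma after_rcons h m : after (rcons h m) = make_move (after h) m.
Proof. exact: foldl_rcons. Qed.

Lemma balanced_after h : legal_play h -> balanced (after h).
Proof.
elim/last_ind: h => [_|h m IHh].
  by rewrite /balanced /stones !(eq_card0 (A := [set _ | _])) // => v;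
    rewrite inE ffunE.
by rewrite legal_play_rcons after_rcons => /andP[/IHh bal_h legal_m];
  exact: balanced_move.
Qed.

(** [permutations] lists each arrangement of the multiset once, giving 9!/(3!)^3 = 1680 boards. *)
Lemma O_not_blocked :
  all (fun c => has_line c PlayerO || (successors PlayerO c != [::]))
      (permutations (nseq 3 None ++
    nseq 3 (Some PlayerX) ++ nseq 3 (Some PlayerO))).
Proof. by vm_compute. Qed.

Lemma O_can_move s :
    balanced s -> mover s = PlayerO -> ~~ over (pos_board s) -> exists m, legal s m.
Proof.
case: s => b p /= + moverO not_over; rewrite {p}moverO /balanced /= => bal.
have [lt6|ge6] := ltnP #|occupied b| 6.
  case: (pickP [pred v | b v == None]) => [v /= bv|full].
    by exists (Place v); rewrite /legal /= not_over lt6.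
  (* Without an empty node all nine would be occupied, against the bound of six. *)
  move: lt6; rewrite (_ : occupied b = setT) ?cardsT ?card_prod ?card_ord //.
  by apply/setP=> v; rewrite !inE; have /= -> := full v.
have [x3 o3] : #|stones b PlayerX| = 3 /\ #|stones b PlayerO| = 3.
  by move: ge6 bal; rewrite card_occupied; move: #|_| #|_| => x o; lia.
have count_x : count_mem (Some PlayerX) (cells b) = 3.
  by rewrite -x3; apply/esym/(card_cells (pred1 (Some PlayerX))).
have count_o : count_mem (Some PlayerO) (cells b) = 3.
  by rewrite -o3; apply/esym/(card_cells (pred1 (Some PlayerO))).
have count_e : count_mem None (cells b) = 3.
  (* The empty cells are the nine cells less the six stones. *)
  have := count_predC (predC1 None) (cells b).
  rewrite -occupied_cells card_occupied x3 o3 size_mkseq.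
  by rewrite (eq_count (a2 := pred1 None)) => [|? /=]; [lia | rewrite negbK].
have count_b y : count_mem y (cells b) = 3 by case: y => [[]|].
have: cells b \in permutations (nseq 3 None ++
    nseq 3 (Some PlayerX) ++ nseq 3 (Some PlayerO)).
  rewrite mem_permutations; apply/allP=> y _; apply/eqP; rewrite count_b.
  by case: y => [[]|].
have := not_over; rewrite /over !wins_cells negb_or => /andP[_ /negPf no_O].
move/(allP O_not_blocked); rewrite no_O.
case succ_b: (successors PlayerO (cells b)) => [//|c cs] _.
have [|m legal_m _] := successor_legal (s := Position b PlayerO) (c := c) not_over.
  by rewrite succ_b mem_head.
by exists m.
Qed.

(** * The strategy of O *)

(** A move that keeps the invariant is preferred, then any legal one; the default
    [Place (ord0, ord0)] is reached only if no move is legal. *)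
Definition reply (s : position) : move :=
  if [pick m | legal s m && held_position (make_move s m)] is Some m then m
  else odflt (Place (ord0, ord0)) [pick m | legal s m].

Lemma reply_legal s : (exists m, legal s m) -> legal s (reply s).
Proof.
case=> m legal_m; rewrite /reply; case: pickP => [? /andP[] //|_].
by case: pickP => //= /(_ m); rewrite legal_m.
Qed.

Lemma reply_held s :
    (exists2 m, legal s m & held_position (make_move s m)) ->
  held_position (make_move s (reply s)).
Proof.
(* Without generalizing, conversion tests unfold the table of safe cells. *)
rewrite /reply; move: held_position => a [m legal_m a_m].
by case: pickP => [? /andP[] //|/(_ m)]; rewrite legal_m a_m.
Qed.

Theorem theorem2p9 :
  exists sigma : seq move -> move,
    is_strategy PlayerO sigma /\
    forall h : seq move,
      legal_play h -> follows PlayerO sigma h ->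
      ~~ wins (pos_board (after h)) PlayerX.
Proof.
(* The strategy is positional: it uses the history only through the position reached. *)
exists (reply \o after); split=> [h play_h moverO not_over|h play_h follows_h].
  exact/reply_legal/O_can_move/not_over/moverO/balanced_after.
apply: held_position_not_wins.
(* Induction on the last move shows that the invariant holds after every play following the
   strategy; prefixes of such a play follow it as well. *)
elim/last_ind: h => [|h m IHh] in play_h follows_h *; first exact: held_start.
move: play_h; rewrite legal_play_rcons after_rcons => /andP[play_h legal_m].
have held_h : held_position (after h).
  apply: IHh => // h1 m1 h2 def_h; apply: (follows_h h1 m1 (rcons h2 m)).
  by rewrite def_h rcons_cat.
case mover_h: (mover (after h)); first exact: held_X_move.
(* On O's turn, [follows] with an empty remainder identifies the last move as the reply. *)
rewrite (follows_h h m [::]) -?cats1 //; apply: reply_held.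
by apply: held_O_move => //; have /andP[] := legal_m.
Qed.
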